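(* Let $\mathsf{X}$ be a subshift over an alphabet $\mathscr{A}$, let $R$ be a commutative unital ring, and let $\pi:\widetilde{\mathcal{A}}_R(\mathsf{X})\to \mathrm{End}_R(\mathbb{P})$ be the homomorphism described in the context. (1) For each $x\in\mathsf{X}$, the submodule $\mathbb{P}_{[x]}$ is $\pi$-invariant, i.e. $\pi(\widetilde{\mathcal{A}}_R(\mathsf{X}))(\mathbb{P}_{[x]})\subseteq\mathbb{P}_{[x]}$. (2) If $R$ is a field then, for each $x\in\mathsf{X}$, the submodule $\mathbb{P}_{[x]}$ is irreducible, in the sense that there is no $R$-submodule $Y$ with $0\neq Y\subsetneq\mathbb{P}_{[x]}$ such that $\pi(\widetilde{\mathcal{A}}_R(\mathsf{X}))(Y)\subseteq Y$.
   Context: $\mathbb{N}=\{0,1,2,\dots\}$. $\mathscr{A}$ is an arbitrary non-empty set (alphabet); $\sigma:\mathscr{A}^{\mathbb{N}}\to\mathscr{A}^{\mathbb{N}}$ is the shift $\sigma(x_1x_2x_3\dots)=x_2x_3\dots$. $\mathscr{A}^*$ is the set of finite words, including the empty word $\omega$. For $F\subseteq\mathscr{A}^*$, the subshift $\mathsf{X}=\mathsf{X}_F$ is the set of all sequences in $\mathscr{A}^{\mathbb{N}}$ no finite (contiguous) subword of which belongs to $F$. The language $\mathcal{L}_{\mathsf{X}}$ is the set of all finite words (including $\omega$) appearing in some element of $\mathsf{X}$. For $\alpha,\beta\in\mathcal{L}_{\mathsf{X}}$ let $C(\alpha,\beta)=\{\beta x\in\mathsf{X}:\alpha x\in\mathsf{X}\}$.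 $\mathcal{U}$ is the Boolean algebra of subsets of $\mathsf{X}$ generated by all $C(\alpha,\beta)$, $\alpha,\beta\in\mathcal{L}_{\mathsf{X}}$ (finite unions, finite intersections, complements in $\mathsf{X}$). The unital subshift algebra $\widetilde{\mathcal{A}}_R(\mathsf{X})$ is the universal unital $R$-algebra with generators $\{p_A:A\in\mathcal{U}\}$ and $\{s_a,s_a^*:a\in\mathscr{A}\}$ subject to: (i) $p_{\mathsf{X}}=1$, $p_{A\cap B}=p_Ap_B$, $p_{A\cup B}=p_A+p_B-p_{A\cap B}$, $p_\emptyset=0$ for all $A,B\in\mathcal{U}$; (ii) $s_as_a^*s_a=s_a$ and $s_a^*s_as_a^*=s_a^*$ for all $a\in\mathscr{A}$; (iii) $s_\beta s_\alpha^*s_\alpha s_\beta^*=p_{C(\alpha,\beta)}$ for all $\alpha,\beta\in\mathcal{L}_{\mathsf{X}}$, where $s_\omega=s_\omega^*=1$ and, for $\alpha=\alpha_1\cdots\alpha_n$, $s_\alpha=s_{\alpha_1}\cdots s_{\alpha_n}$, $s_\alpha^*=s_{\alpha_n}^*\cdots s_{\alpha_1}^*$. $\mathbb{P}$ is the free $R$-module with basis $\{\delta_x:x\in\mathsf{X}\}$. For a statement $p$, $[p]=1$ if $p$ is true and $[p]=0$ otherwise. $\pi:\widetilde{\mathcal{A}}_R(\mathsf{X})\to\mathrm{End}_R(\mathbb{P})$ is the unique $R$-algebra homomorphism with $\pi(p_A)=P_A$, $\pi(s_a)=S_a$, $\pi(s_a^* )=S_a^*$ for $A\in\mathcal{U}$,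 $a\in\mathscr{A}$, where for $x=x_1x_2x_3\dots\in\mathsf{X}$: $P_A(\delta_x)=[x\in A]\,\delta_x$, $S_a(\delta_x)=[ax\in\mathsf{X}]\,\delta_{ax}$, $S_a^*(\delta_x)=[x_1=a]\,\delta_{\sigma(x)}$ (the value being $0$ when the bracket is $0$). For $x,y\in\mathsf{X}$ write $x\sim y$ if $\sigma^n(x)=\sigma^m(y)$ for some $n,m\in\mathbb{N}$; this is an equivalence relation, and the class of $x$ is also denoted $[x]$. $\mathbb{P}_{[x]}$ is the $R$-submodule of $\mathbb{P}$ generated by $\{\delta_y:y\in[x]\}$. *)

(* Defs.v *)
From HB Require Import structures.
From mathcomp Require Import all_boot all_algebra finmap all_classical.

Set Implicit Arguments.
Unset Strict Implicit.
Unset Printing Implicit Defensive.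

Import GRing.Theory.
Local Open Scope classical_set_scope.
Local Open Scope ring_scope.

(* A unital R-algebra: a ring B with a ring morphism r |-> r * 1 from R to the
   center of B. The library's algType requires 1 != 0 in B, which fails for the
   algebras below when R is the zero ring or the subshift is empty. *)
HB.mixin Record isUnitalAlgebra (R : comPzRingType) B of GRing.PzRing B := {
  ualg : R -> B;
  ualg1 : ualg 1 = 1;
  ualgD : {morph ualg : r s / r + s};
  ualgM : {morph ualg : r s / r * s};
  ualgC : forall r u, ualg r * u = u * ualg r }.

#[short(type="unitalAlgType")]
HB.structure Definition UnitalAlgebra (R : comPzRingType) :=
  { B of GRing.PzRing B & isUnitalAlgebra R B }.

Definition ualg_morphism (R : comPzRingType) (B C : unitalAlgType R)
    (f : B -> C) : Prop :=
  forall r : R, f (ualg r) = ualg r.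

Inductive aterm (R G : Type) : Type :=
| AGen of G
| AScal of R
| AOpp of aterm R G
| AAdd of aterm R G & aterm R G
| AMul of aterm R G & aterm R G.

Arguments AGen {R G}.
Arguments AScal {R G}.

HB.instance Definition _ R G := gen_eqMixin (aterm R G).
HB.instance Definition _ R G := gen_choiceMixin (aterm R G).

(* The least congruence that contains rel and whose quotient is a unital
   R-algebra. *)
Inductive acong (R : comPzRingType) (G : Type)
    (rel : aterm R G -> aterm R G -> Prop) : aterm R G -> aterm R G -> Prop :=
| acong_rel t u : rel t u -> acong rel t u
| acong_refl t : acong rel t t
| acong_sym t u : acong rel t u -> acong rel u t
| acong_trans t u v : acong rel t u -> acong rel u v -> acong rel t v
| acong_opp t u : acong rel t u -> acong rel (AOpp t) (AOpp u)
| acong_add t t' u u' : acong rel t t' -> acong rel u u' ->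
    acong rel (AAdd t u) (AAdd t' u')
| acong_mul t t' u u' : acong rel t t' -> acong rel u u' ->
    acong rel (AMul t u) (AMul t' u')
| acong_addA t u v : acong rel (AAdd t (AAdd u v)) (AAdd (AAdd t u) v)
| acong_addC t u : acong rel (AAdd t u) (AAdd u t)
| acong_add0 t : acong rel (AAdd (AScal 0) t) t
| acong_addN t : acong rel (AAdd (AOpp t) t) (AScal 0)
| acong_mulA t u v : acong rel (AMul t (AMul u v)) (AMul (AMul t u) v)
| acong_mul1l t : acong rel (AMul (AScal 1) t) t
| acong_mul1r t : acong rel (AMul t (AScal 1)) t
| acong_mulDl t u v :
    acong rel (AMul (AAdd t u) v) (AAdd (AMul t v) (AMul u v))
| acong_mulDr t u v :
    acong rel (AMul t (AAdd u v)) (AAdd (AMul t u) (AMul t v))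
| acong_scalD r s : acong rel (AScal (r + s)) (AAdd (AScal r) (AScal s))
| acong_scalM r s : acong rel (AScal (r * s)) (AMul (AScal r) (AScal s))
| acong_scalC r t : acong rel (AMul (AScal r) t) (AMul t (AScal r)).

Section Presented.
Variables (R : comPzRingType) (G : Type).
Variable rel : aterm R G -> aterm R G -> Prop.

Definition acongb (t u : aterm R G) : bool := `[< acong rel t u >].

Lemma acongb_equiv : equiv_class_of acongb.
Proof.
split=> [t|t u|u t v].
- exact/asboolP/acong_refl.
- by apply/asboolP/asboolP; exact: acong_sym.
- by move=> /asboolP tu /asboolP uv; apply/asboolP; exact: acong_trans uv.
Qed.

Canonical acongb_equivrel := EquivRelPack acongb_equiv.

Definition presented : Type := {eq_quot acongb_equivrel}%qT.

HB.instance Definition _ := Choice.on presented.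
HB.instance Definition _ := EqQuotient.on presented.

Definition pclass (t : aterm R G) : presented := (\pi_presented t)%qT.

Lemma pclassP t u : pclass t = pclass u <-> acong rel t u.
Proof.
rewrite /pclass; split=> [/eqquotP/asboolP//|tu].
exact/eqquotP/asboolP.
Qed.

Lemma pclass_repr (q : presented) : pclass (repr q) = q.
Proof. exact: reprK. Qed.

Lemma repr_pclass t : acong rel (repr (pclass t)) t.
Proof. by apply/pclassP; rewrite pclass_repr. Qed.

Definition presented_opp (q : presented) := pclass (AOpp (repr q)).
Definition presented_add (q q' : presented) := pclass (AAdd (repr q) (repr q')).
Definition presented_mul (q q' : presented) := pclass (AMul (repr q) (repr q')).
Definition presented_scal (r : R) := pclass (AScal r).

Lemma presented_oppE t : presented_opp (pclass t) = pclass (AOpp t).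
Proof. by apply/pclassP/acong_opp/repr_pclass. Qed.

Lemma presented_addE t u :
  presented_add (pclass t) (pclass u) = pclass (AAdd t u).
Proof. by apply/pclassP/acong_add; apply/repr_pclass. Qed.

Lemma presented_mulE t u :
  presented_mul (pclass t) (pclass u) = pclass (AMul t u).
Proof. by apply/pclassP/acong_mul; apply/repr_pclass. Qed.

Let opE := (presented_oppE, presented_addE, presented_mulE).

Lemma presented_ind (P : presented -> Prop) :
  (forall t, P (pclass t)) -> forall q, P q.
Proof. by move=> Pt q; rewrite -(pclass_repr q). Qed.

Fact presented_addA : associative presented_add.
Proof.
by do 3!elim/presented_ind=> ?; rewrite !opE; apply/pclassP/acong_addA.
Qed.

Fact presented_addC : commutative presented_add.
Proof.
by do 2!elim/presented_ind=> ?; rewrite !opE; apply/pclassP/acong_addC.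
Qed.

Fact presented_add0 : left_id (presented_scal 0) presented_add.
Proof. by elim/presented_ind=> ?; rewrite !opE; apply/pclassP/acong_add0. Qed.

Fact presented_addN :
  left_inverse (presented_scal 0) presented_opp presented_add.
Proof. by elim/presented_ind=> ?; rewrite !opE; apply/pclassP/acong_addN. Qed.

HB.instance Definition _ := GRing.isZmodule.Build presented
  presented_addA presented_addC presented_add0 presented_addN.

Fact presented_mulA : associative presented_mul.
Proof.
by do 3!elim/presented_ind=> ?; rewrite !opE; apply/pclassP/acong_mulA.
Qed.

Fact presented_mul1l : left_id (presented_scal 1) presented_mul.
Proof. by elim/presented_ind=> ?; rewrite !opE; apply/pclassP/acong_mul1l. Qed.

Fact presented_mul1r : right_id (presented_scal 1) presented_mul.
Proof. by elim/presented_ind=> ?; rewrite !opE; apply/pclassP/acong_mul1r. Qed.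

Fact presented_mulDl : left_distributive presented_mul presented_add.
Proof.
by do 3!elim/presented_ind=> ?; rewrite !opE; apply/pclassP/acong_mulDl.
Qed.

Fact presented_mulDr : right_distributive presented_mul presented_add.
Proof.
by do 3!elim/presented_ind=> ?; rewrite !opE; apply/pclassP/acong_mulDr.
Qed.

HB.instance Definition _ := GRing.Zmodule_isPzRing.Build presented
  presented_mulA presented_mul1l presented_mul1r
  presented_mulDl presented_mulDr.

Fact presented_scalD : {morph presented_scal : r s / r + s}.
Proof.
move=> r s; rewrite [RHS]presented_addE; exact/pclassP/acong_scalD.
Qed.

Fact presented_scalM : {morph presented_scal : r s / r * s}.
Proof.
move=> r s; rewrite [RHS]presented_mulE; exact/pclassP/acong_scalM.
Qed.

Fact presented_scalC r (q : presented) :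
  presented_scal r * q = q * presented_scal r.
Proof.
elim/presented_ind: q => t.
rewrite [LHS]presented_mulE [RHS]presented_mulE; exact/pclassP/acong_scalC.
Qed.

HB.instance Definition _ := isUnitalAlgebra.Build R presented
  (erefl _) presented_scalD presented_scalM presented_scalC.

Definition pgen (g : G) : presented := pclass (AGen g).

Section Lift.
Variables (B : unitalAlgType R) (phi : G -> B).

Fixpoint aeval (t : aterm R G) : B :=
  match t with
  | AGen g => phi g
  | AScal r => ualg r
  | AOpp u => - aeval u
  | AAdd u v => aeval u + aeval v
  | AMul u v => aeval u * aeval v
  end.

Definition satisfies : Prop := forall t u, rel t u -> aeval t = aeval u.

Lemma ualg0 : ualg 0 = 0 :> B.
Proof. by apply: (addrI (ualg 0 : B)); rewrite -ualgD !addr0. Qed.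

Hypothesis phi_rel : satisfies.

Lemma aeval_acong t u : acong rel t u -> aeval t = aeval u.
Proof.
elim=> //=.
- by move=> *; congruence.
- by move=> ? ? _ ->.
- by move=> ????? -> _ ->.
- by move=> ????? -> _ ->.
- by move=> *; rewrite addrA.
- by move=> *; rewrite addrC.
- by move=> *; rewrite ualg0 add0r.
- by move=> *; rewrite ualg0 addNr.
- by move=> *; rewrite mulrA.
- by move=> *; rewrite ualg1 mul1r.
- by move=> *; rewrite ualg1 mulr1.
- by move=> *; rewrite mulrDl.
- by move=> *; rewrite mulrDr.
- by move=> *; rewrite ualgD.
- by move=> *; rewrite ualgM.
- by move=> *; rewrite ualgC.
Qed.

Definition plift_fun (_ : satisfies) (q : presented) : B := aeval (repr q).

Lemma plift_class t : plift_fun phi_rel (pclass t) = aeval t.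
Proof. exact/aeval_acong/repr_pclass. Qed.

Fact plift_zmod_morphism : zmod_morphism (plift_fun phi_rel).
Proof.
move=> q q'; elim/presented_ind: q => t; elim/presented_ind: q' => u.
have -> : pclass t - pclass u = pclass (AAdd t (AOpp u)).
  by rewrite -presented_addE -presented_oppE.
by rewrite !plift_class.
Qed.

Fact plift_monoid_morphism : monoid_morphism (plift_fun phi_rel).
Proof.
split=> [|q q'].
  by rewrite -[RHS](ualg1 (R := R)) -[RHS]/(aeval (AScal 1)) -plift_class.
elim/presented_ind: q => t; elim/presented_ind: q' => u.
by rewrite [pclass t * _]presented_mulE !plift_class.
Qed.

HB.instance Definition _ := GRing.isZmodMorphism.Build presented B
  (plift_fun phi_rel) plift_zmod_morphism.
HB.instance Definition _ := GRing.isMonoidMorphism.Build presented B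
  (plift_fun phi_rel) plift_monoid_morphism.

Definition plift : {rmorphism presented -> B} := plift_fun phi_rel.

Lemma plift_ualg : ualg_morphism (R := R) plift.
Proof. by move=> r; rewrite [LHS]plift_class. Qed.

Lemma plift_gen g : plift (pgen g) = phi g.
Proof. exact: plift_class. Qed.

Lemma plift_unique (f : {rmorphism presented -> B}) :
  ualg_morphism (R := R) f -> (forall g, f (pgen g) = phi g) -> f =1 plift.
Proof.
move=> fu fg; elim/presented_ind; elim.
- by move=> g; rewrite [LHS]fg plift_gen.
- by move=> r; rewrite [LHS]fu [RHS]plift_ualg.
- by move=> t IH; rewrite -presented_oppE [LHS]rmorphN [RHS]rmorphN; congr -%R.
- move=> t IHt u IHu.
  by rewrite -presented_addE [LHS]rmorphD [RHS]rmorphD; congr +%R.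
- move=> t IHt u IHu.
  by rewrite -presented_mulE [LHS]rmorphM [RHS]rmorphM; congr *%R.
Qed.

End Lift.
End Presented.

Section Endomorphisms.
Variables (R : comPzRingType) (V : lmodType R).

Definition endo : Type := {linear V -> V}.

HB.instance Definition _ := gen_eqMixin endo.
HB.instance Definition _ := gen_choiceMixin endo.

Lemma endoP (f g : endo) : (forall v, f v = g v) -> f = g.
Proof.
case: f g => [f [[f1] [f2]]] [g [[g1] [g2]]] /= /funext fg.
case: g / fg g1 g2 => g1 g2.
by rewrite (Prop_irrelevance f1 g1) (Prop_irrelevance f2 g2).
Qed.

Definition endo_zero : endo := \0.
Definition endo_opp (f : endo) : endo := \- f.
Definition endo_add (f g : endo) : endo := f \+ g.
Definition endo_one : endo := idfun.
Definition endo_mul (f g : endo) : endo := f \o g.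
Definition endo_scal (r : R) : endo := *:%R r.

Fact endo_addA : associative endo_add.
Proof. by move=> f g h; apply: endoP => v; exact: addrA. Qed.

Fact endo_addC : commutative endo_add.
Proof. by move=> f g; apply: endoP => v; exact: addrC. Qed.

Fact endo_add0 : left_id endo_zero endo_add.
Proof. by move=> f; apply: endoP => v; exact: add0r. Qed.

Fact endo_addN : left_inverse endo_zero endo_opp endo_add.
Proof. by move=> f; apply: endoP => v; exact: addNr. Qed.

HB.instance Definition _ := GRing.isZmodule.Build endo
  endo_addA endo_addC endo_add0 endo_addN.

Fact endo_mulA : associative endo_mul.
Proof. by move=> f g h; apply: endoP. Qed.

Fact endo_mul1l : left_id endo_one endo_mul.
Proof. by move=> f; apply: endoP. Qed.

Fact endo_mul1r : right_id endo_one endo_mul.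
Proof. by move=> f; apply: endoP. Qed.

Fact endo_mulDl : left_distributive endo_mul endo_add.
Proof. by move=> f g h; apply: endoP. Qed.

Fact endo_mulDr : right_distributive endo_mul endo_add.
Proof. by move=> f g h; apply: endoP => v; exact: linearD. Qed.

HB.instance Definition _ := GRing.Zmodule_isPzRing.Build endo
  endo_mulA endo_mul1l endo_mul1r endo_mulDl endo_mulDr.

Fact endo_scal1 : endo_scal 1 = 1.
Proof. by apply: endoP => v; exact: scale1r. Qed.

Fact endo_scalD : {morph endo_scal : r s / r + s}.
Proof. by move=> r s; apply: endoP => v; exact: scalerDl. Qed.

Fact endo_scalM : {morph endo_scal : r s / r * s}.
Proof. by move=> r s; apply: endoP => v; rewrite /= scalerA. Qed.

Fact endo_scalC r (f : endo) : endo_scal r * f = f * endo_scal r.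
Proof. by apply: endoP => v; rewrite [RHS]linearZ. Qed.

HB.instance Definition _ := isUnitalAlgebra.Build R endo
  endo_scal1 endo_scalD endo_scalM endo_scalC.

Lemma endoME (f g : endo) v : (f * g) v = f (g v).
Proof. by []. Qed.

Lemma endoDE (f g : endo) v : (f + g) v = f v + g v.
Proof. by []. Qed.

Lemma endoNE (f : endo) v : (- f) v = - f v.
Proof. by []. Qed.

Lemma endo0E v : (0 : endo) v = 0.
Proof. by []. Qed.

Lemma endo1E v : (1 : endo) v = v.
Proof. by []. Qed.

Lemma endo_ualgE (r : R) v : (ualg r : endo) v = r *: v.
Proof. by []. Qed.

End Endomorphisms.

Section Submodules.
Variables (R : comPzRingType) (V : lmodType R).

Definition submodule (Y : set V) : Prop := GRing.submod_closed (mem Y).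

Definition submodule_span (G : set V) : set V := smallest submodule G.

Lemma submoduleP (Y : set V) :
  submodule Y <->
  [/\ Y 0, forall u v, Y u -> Y v -> Y (u + v) & forall r u, Y u -> Y (r *: u)].
Proof.
split=> [[Y0 YL]|[Y0 YD YZ]].
  have {}Y0 : Y 0 by exact/set_mem.
  have {}YL r u v : Y u -> Y v -> Y (r *: u + v).
    by move=> /mem_set Yu /mem_set Yv; apply/set_mem/YL.
  split=> // [u v Yu Yv|r u Yu]; first by rewrite -[u]scale1r; exact: YL.
  by rewrite -[_ *: _]addr0; exact: YL.
split; first exact/mem_set.
move=> r u v /set_mem Yu /set_mem Yv; apply/mem_set/YD => //; exact: YZ.
Qed.

Lemma submodule_span_submodule (G : set V) : submodule (submodule_span G).
Proof.
apply/submoduleP; split=> [Y [+ _]|u v Yu Yv Y YG|r u Yu Y YG].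
- by case/submoduleP.
- have := YG; case=> /submoduleP[_ YD _] _; apply: YD; [exact: Yu|exact: Yv].
- have := YG; case=> /submoduleP[_ _ YZ] _; apply: YZ; exact: Yu.
Qed.

End Submodules.

Section FreeModule.
Variables (R : comPzRingType) (T : choiceType).

Definition finsupp : {pred (T -> R^o)} :=
  fun f => `[< finite_set [set x | f x != 0] >].

Fact finsupp_submod_closed : GRing.submod_closed finsupp.
Proof.
split=> [|r f g /asboolP fF /asboolP gF]; apply/asboolP.
  by apply: (@sub_finite_set _ _ set0) => // x /=; rewrite eqxx.
apply: (@sub_finite_set _ _ ([set x | f x != 0] `|` [set x | g x != 0])).
  move=> x /= fgx; case: (eqVneq (f x) 0) => fx; [right|by left].
  apply: contraNN fgx => /eqP gx; apply/eqP.
  by rewrite -[LHS]/(r * f x + g x) fx gx mulr0 addr0.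
by rewrite finite_setU.
Qed.

HB.instance Definition _ := GRing.isSubmodClosed.Build R (T -> R^o) finsupp
  finsupp_submod_closed.

Record freemod : Type := Freemod { coef :> T -> R^o; _ : coef \in finsupp }.

HB.instance Definition _ := [isSub for coef].
HB.instance Definition _ := [Choice of freemod by <:].
HB.instance Definition _ := [SubChoice_isSubLmodule of freemod by <:].

Lemma freemodP (f g : freemod) : (forall x, f x = g x) -> f = g.
Proof. by move=> fg; apply/val_inj/funext. Qed.

Lemma freemod_finite (f : freemod) : finite_set [set x | f x != 0].
Proof. exact/asboolP/(valP f). Qed.

Lemma freemod0E x : (0 : freemod) x = 0.
Proof. by []. Qed.

Lemma freemodDE (f g : freemod) x : (f + g) x = f x + g x.
Proof. by []. Qed.

Lemma freemodZE (r : R) (f : freemod) x : (r *: f) x = r * f x.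
Proof. by []. Qed.

Fact delta_subproof (x : T) : (fun y => (y == x)%:R : R^o) \in finsupp.
Proof.
apply/asboolP/(@sub_finite_set _ _ [set x]) => // y /=.
by case: (y =P x) => //; rewrite eqxx.
Qed.

Definition delta (x : T) : freemod := Freemod (delta_subproof x).

Lemma deltaE x y : delta x y = (y == x)%:R.
Proof. by []. Qed.

Section Extension.
Variables (V : lmodType R) (phi : T -> V).

Definition freemod_ext_fun (f : freemod) : V :=
  \sum_(x \in [set: T]) (f x : R) *: phi x.

Lemma freemod_ext_funE (S : {fset T}) (f : freemod) :
  (forall x, f x != 0 -> x \in S) ->
  freemod_ext_fun f = \sum_(x <- S) (f x : R) *: phi x.
Proof.
move=> fS; apply: fsbigTE => x xS.
have -> : f x = 0 by apply/eqP; apply: contraNT xS; exact: fS.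
by rewrite scale0r.
Qed.

Fact freemod_ext_linear : linear freemod_ext_fun.
Proof.
move=> r f g.
pose S := (fset_set [set x | f x != 0] `|` fset_set [set x | g x != 0])%fset.
have fS x : f x != 0 -> x \in S.
  move=> fx; rewrite in_fsetU in_fset_set; last exact: freemod_finite.
  by rewrite mem_set.
have gS x : g x != 0 -> x \in S.
  move=> gx; rewrite in_fsetU orbC in_fset_set; last exact: freemod_finite.
  by rewrite mem_set.
rewrite (freemod_ext_funE fS) (freemod_ext_funE gS) (@freemod_ext_funE S).
  rewrite scaler_sumr -big_split /=; apply: eq_bigr => x _.
  by rewrite scalerA -scalerDl.
move=> x; case: (eqVneq (f x) 0) => [fx|/fS//].
case: (eqVneq (g x) 0) => [gx|/gS//].
by rewrite freemodDE freemodZE fx gx mulr0 addr0 eqxx.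
Qed.

HB.instance Definition _ := GRing.isLinear.Build R freemod V _ freemod_ext_fun
  freemod_ext_linear.

Definition freemod_ext : {linear freemod -> V} := freemod_ext_fun.

Lemma freemod_ext_delta x : freemod_ext (delta x) = phi x.
Proof.
rewrite [LHS](@freemod_ext_funE [fset x]%fset) => [|y].
  by rewrite big_seq_fset1 deltaE eqxx scale1r.
by rewrite deltaE in_fset1; case: (y =P x) => //; rewrite eqxx.
Qed.

End Extension.

Lemma freemod_decomp (f : freemod) : f = freemod_ext delta f.
Proof.
apply: freemodP => y.
pose S := fset_set [set x | f x != 0].
have SE x : (x \in S) = (f x != 0).
  rewrite in_fset_set; last exact: freemod_finite.
  by apply/idP/idP; rewrite inE.
rewrite [freemod_ext _ _](@freemod_ext_funE _ _ S) => [|x]; last by rewrite SE.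
rewrite (big_morph (fun g : freemod => g y) (fun g h => freemodDE g h y)
  (freemod0E y)).
rewrite (eq_bigr (fun x => if x == y then f y else 0)); last first.
  move=> x _; rewrite freemodZE deltaE eq_sym; case: eqP => [->|_].
    by rewrite mulr1.
  by rewrite mulr0.
rewrite -big_mkcond /=; case: (boolP (y \in S)) => yS.
  rewrite -big_filter (_ : [seq _ <- _ | _] = [:: y]) ?big_seq1 //.
  by rewrite filter_pred1_uniq ?fset_uniq.
rewrite big_seq_cond big1 => [|x /andP[xS /eqP xy]].
  by apply/eqP; move: yS; rewrite SE negbK.
by rewrite -xy xS in yS.
Qed.

Lemma freemod_linear_ext (V : lmodType R) (f g : {linear freemod -> V}) :
  (forall x, f (delta x) = g (delta x)) -> forall v, f v = g v.
Proof.
move=> fg v; rewrite (freemod_decomp v).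
rewrite [freemod_ext _ _](@freemod_ext_funE _ _ (fset_set [set x | v x != 0])).
  by rewrite !linear_sum; apply: eq_bigr => x _; rewrite !linearZ /= fg.
move=> x vx; rewrite in_fset_set; last exact: freemod_finite.
by rewrite mem_set.
Qed.

End FreeModule.

Section Subshift.
Variable A : Type.
Implicit Types (w alpha beta : seq A) (x : nat -> A).

(* The sequence x_1 x_2 x_3 ... is the function n |-> x_(n+1). *)
Definition shift x : nat -> A := fun n => x n.+1.

Definition scons (a : A) x : nat -> A := fun n => if n is m.+1 then x m else a.

Definition wcat w x : nat -> A := foldr scons x w.

(* The empty word occurs in every sequence. *)
Definition occurs w x : Prop := exists i, w = [seq x k | k <- iota i (size w)].

Variable F : set (seq A).

Definition subshift : set (nat -> A) :=
  [set x | forall w, F w -> ~ occurs w x].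

Definition language : set (seq A) :=
  [set w | exists2 x, subshift x & occurs w x].

Record spoint : Type := SPoint { pval :> nat -> A; pvalP : subshift pval }.
Arguments pvalP : clear implicits.

HB.instance Definition _ := gen_eqMixin spoint.
HB.instance Definition _ := gen_choiceMixin spoint.

Lemma spoint_inj (x y : spoint) : (x : nat -> A) = y -> x = y.
Proof.
case: x y => [x xX] [y yX] /= xy; case: y / xy yX => yX.
by rewrite (Prop_irrelevance xX yX).
Qed.

Lemma occurs_shift w x : occurs w (shift x) -> occurs w x.
Proof.
case=> i wE; exists i.+1.
by rewrite [LHS]wE -[i.+1]addn1 addnC iotaDl -map_comp.
Qed.

Lemma subshift_shift x : subshift x -> subshift (shift x).
Proof. by move=> xX w Fw /occurs_shift; exact: xX. Qed.

Definition pshift (x : spoint) : spoint := SPoint (subshift_shift (pvalP x)).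

Definition Cset alpha beta : set spoint :=
  [set y | exists x, (y : nat -> A) = wcat beta x /\ subshift (wcat alpha x)].

Inductive boolalg : set (set spoint) :=
| boolalg_C alpha beta :
    language alpha -> language beta -> boolalg (Cset alpha beta)
| boolalg_T : boolalg setT
| boolalg_0 : boolalg set0
| boolalg_I (B D : set spoint) : boolalg B -> boolalg D -> boolalg (B `&` D)
| boolalg_U (B D : set spoint) : boolalg B -> boolalg D -> boolalg (B `|` D)
| boolalg_N (B : set spoint) : boolalg B -> boolalg (~` B).

Record belt : Type := Belt { bset :> set spoint; bsetP : boolalg bset }.

Definition beltC alpha beta (la : language alpha) (lb : language beta) : belt :=
  Belt (boolalg_C la lb).
Definition beltT : belt := Belt boolalg_T.
Definition belt0 : belt := Belt boolalg_0.
Definition beltI (B D : belt) : belt := Belt (boolalg_I (bsetP B) (bsetP D)).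
Definition beltU (B D : belt) : belt := Belt (boolalg_U (bsetP B) (bsetP D)).

Inductive sgen : Type := GP of belt | GS of A | GSs of A.

Section Algebra.
Variable R : comPzRingType.

Definition tp (B : belt) : aterm R sgen := AGen (GP B).
Definition ts (a : A) : aterm R sgen := AGen (GS a).
Definition tss (a : A) : aterm R sgen := AGen (GSs a).

(* For alpha = a_1 ... a_n, tsw is s_(a_1) ... s_(a_n), while tssw reverses the
   order and is ss_(a_n) ... ss_(a_1). *)
Definition tsw alpha : aterm R sgen :=
  foldr (fun a t => AMul (ts a) t) (AScal 1) alpha.
Definition tssw alpha : aterm R sgen :=
  foldr (fun a t => AMul t (tss a)) (AScal 1) alpha.

Inductive srel : aterm R sgen -> aterm R sgen -> Prop :=
| srel_T : srel (tp beltT) (AScal 1)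
| srel_I B D : srel (tp (beltI B D)) (AMul (tp B) (tp D))
| srel_U B D :
    srel (tp (beltU B D)) (AAdd (AAdd (tp B) (tp D)) (AOpp (tp (beltI B D))))
| srel_0 : srel (tp belt0) (AScal 0)
| srel_s a : srel (AMul (AMul (ts a) (tss a)) (ts a)) (ts a)
| srel_ss a : srel (AMul (AMul (tss a) (ts a)) (tss a)) (tss a)
| srel_C alpha beta (la : language alpha) (lb : language beta) :
    srel (AMul (AMul (AMul (tsw beta) (tssw alpha)) (tsw alpha)) (tssw beta))
         (tp (beltC la lb)).

Definition subshift_algebra : Type := presented srel.

HB.instance Definition _ := UnitalAlgebra.on subshift_algebra.

Definition gen_p (B : belt) : subshift_algebra := pgen srel (GP B).
Definition gen_s (a : A) : subshift_algebra := pgen srel (GS a).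
Definition gen_ss (a : A) : subshift_algebra := pgen srel (GSs a).

Definition PX : lmodType R := freemod R spoint.

Definition opP (B : set spoint) : endo PX :=
  freemod_ext (fun x : spoint => if `[< B x >] then delta R x else 0 : PX).

Definition opS (a : A) : endo PX :=
  freemod_ext (fun x : spoint => if pselect (subshift (scons a x)) is left ax
                        then delta R (SPoint ax) else 0 : PX).

Definition opSs (a : A) : endo PX :=
  freemod_ext (fun x : spoint =>
    if `[< x 0%N = a >] then delta R (pshift x) else 0 : PX).

Arguments opP : simpl never.
Arguments opS : simpl never.
Arguments opSs : simpl never.

Definition op_gen (g : sgen) : endo PX :=
  match g with GP B => opP B | GS a => opS a | GSs a => opSs a end.

Lemma opPE (B : set spoint) (x : spoint) :
  opP B (delta R x) = if `[< B x >] then delta R x else 0.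
Proof. exact: freemod_ext_delta. Qed.

Lemma opSE a (x : spoint) :
  opS a (delta R x) = if pselect (subshift (scons a x)) is left ax
                      then delta R (SPoint ax) else 0.
Proof. exact: freemod_ext_delta. Qed.

Lemma opSsE a (x : spoint) :
  opSs a (delta R x) = if `[< x 0%N = a >] then delta R (pshift x) else 0.
Proof. exact: freemod_ext_delta. Qed.

Lemma endo_delta (f g : endo PX) :
  (forall x : spoint, f (delta R x) = g (delta R x)) -> f = g.
Proof. by move=> fg; apply: endoP; exact: freemod_linear_ext. Qed.

Lemma shift_scons a x : shift (scons a x) = x.
Proof. exact/funext. Qed.

Lemma scons_shift x : scons (x 0%N) (shift x) = x.
Proof. by apply/funext; case. Qed.

Lemma scons_inj a b x y : scons a x = scons b y -> a = b /\ x = y.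
Proof.
move=> E; split; first exact: (congr1 (fun z => z 0%N) E).
by rewrite -(shift_scons a x) E shift_scons.
Qed.

Lemma wcat_inj w x y : wcat w x = wcat w y -> x = y.
Proof. by elim: w => //= a w IH /scons_inj[_]; exact: IH. Qed.

Lemma subshift_wcat w x : subshift (wcat w x) -> subshift x.
Proof.
elim: w => //= a w IH /subshift_shift.
by rewrite shift_scons; exact: IH.
Qed.

Lemma aeval_tsw alpha (x y : spoint) : (y : nat -> A) = wcat alpha x ->
  aeval op_gen (tsw alpha) (delta R x) = delta R y.
Proof.
elim: alpha y => [|a alpha IH] y yE /=.
  by rewrite endo_ualgE scale1r; congr delta; exact: spoint_inj.
have zX : subshift (wcat alpha x).
  rewrite -(shift_scons a (wcat _ _)) -[scons _ _]yE.
  exact/subshift_shift/pvalP.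
rewrite (IH (SPoint zX)) // opSE; case: pselect => [aX|[]] /=.
  by congr delta; exact: spoint_inj.
by rewrite -[scons _ _]yE; exact: pvalP.
Qed.

Lemma aeval_tsw0 alpha (x : spoint) : ~ subshift (wcat alpha x) ->
  aeval op_gen (tsw alpha) (delta R x) = 0.
Proof.
elim: alpha => [[]|a alpha IH /=]; first exact: pvalP.
move=> aX; case: (pselect (subshift (wcat alpha x))) => zX; last first.
  by rewrite IH ?linear0.
by rewrite (@aeval_tsw _ _ (SPoint zX)) // opSE; case: pselect.
Qed.

Lemma aeval_tssw beta (x y : spoint) : (y : nat -> A) = wcat beta x ->
  aeval op_gen (tssw beta) (delta R y) = delta R x.
Proof.
elim: beta y => [|b beta IH] y yE /=.
  by rewrite endo_ualgE scale1r; congr delta; exact: spoint_inj.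
rewrite opSsE yE /= asboolT // IH //=.
by rewrite yE /= shift_scons.
Qed.

Lemma aeval_tssw0 beta (y : spoint) :
  ~ (exists x, (y : nat -> A) = wcat beta x) ->
  aeval op_gen (tssw beta) (delta R y) = 0.
Proof.
elim: beta y => [y []|b beta IH y nE /=]; first by exists y.
rewrite opSsE; case: asboolP => [yb|_]; last by rewrite linear0.
apply: IH => -[x xE]; apply: nE; exists x.
by rewrite /= -xE -yb scons_shift.
Qed.

Lemma opP_satisfies : satisfies srel op_gen.
Proof.
move=> _ _ [|B D|B D||a|a|alpha beta la lb] /=; apply: endo_delta => y /=;
  rewrite ?endo0E.
- by rewrite opPE asboolT // endo_ualgE scale1r.
- rewrite !opPE; case: (asboolP (bset D y)) => Dy.
    rewrite opPE; case: (asboolP (bset B y)) => By; first by rewrite asboolT.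
    by rewrite asboolF // => -[].
  by rewrite linear0 asboolF // => -[].
- rewrite !opPE; case: (asboolP (bset B y)) => By;
    case: (asboolP (bset D y)) => Dy.
  + by rewrite !asboolT //; [rewrite addrK|left].
  + rewrite asboolT; last by left.
    by rewrite asboolF ?subr0 ?addr0 // => -[].
  + rewrite asboolT; last by right.
    by rewrite asboolF ?subr0 ?add0r // => -[].
  + rewrite asboolF; last by case.
    by rewrite asboolF ?subr0 ?add0r // => -[].
- by rewrite opPE asboolF // endo_ualgE scale0r.
- rewrite opSE; case: pselect => [aX|_]; last by rewrite !linear0.
  rewrite opSsE asboolT // opSE /=.
  rewrite shift_scons; case: pselect => // aX'.
  by congr delta; exact: spoint_inj.
- rewrite opSsE; case: asboolP => [ya|_]; last by rewrite !linear0.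
  rewrite opSE /=; case: pselect => [aX|[]]; last first.
    by rewrite -ya scons_shift; exact: pvalP.
  rewrite opSsE asboolT //; congr delta; apply: spoint_inj.
  by rewrite /= shift_scons.
- rewrite opPE.
  case: (pselect (exists x, (y : nat -> A) = wcat beta x)) => [[x yE]|nE].
    have xX : subshift x.
      by apply: (@subshift_wcat beta); rewrite -yE; exact: pvalP.
    rewrite (@aeval_tssw _ (SPoint xX)) //.
    case: (pselect (subshift (wcat alpha x))) => aX.
      rewrite (@aeval_tsw _ _ (SPoint aX)) // (@aeval_tssw _ (SPoint xX)) //.
      by rewrite (@aeval_tsw _ _ y) // asboolT //; exists x.
    rewrite aeval_tsw0 // !linear0 asboolF // => -[z [zE zX]].
    by apply: aX; rewrite yE in zE; rewrite (wcat_inj zE).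
  rewrite aeval_tssw0 // !linear0 asboolF // => -[x [xE _]].
  by apply: nE; exists x.
Qed.

Definition rep : {rmorphism subshift_algebra -> endo PX} := plift opP_satisfies.

Lemma rep_ualg : ualg_morphism (R := R) rep.
Proof. exact: plift_ualg. Qed.

Lemma rep_p B : rep (gen_p B) = opP B.
Proof. exact: plift_gen. Qed.

Lemma rep_s a : rep (gen_s a) = opS a.
Proof. exact: plift_gen. Qed.

Lemma rep_ss a : rep (gen_ss a) = opSs a.
Proof. exact: plift_gen. Qed.

Lemma rep_unique (f : {rmorphism subshift_algebra -> endo PX}) :
  ualg_morphism (R := R) f ->
  (forall B, f (gen_p B) = opP B) -> (forall a, f (gen_s a) = opS a) ->
  (forall a, f (gen_ss a) = opSs a) -> f =1 rep.
Proof. by move=> fu fp fs fss; apply: plift_unique => // -[]. Qed.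

Definition tail_equiv (x y : nat -> A) : Prop :=
  exists n m, iter n shift x = iter m shift y.

Definition class_module (x : spoint) : set PX :=
  submodule_span [set delta R y | y in [set y : spoint | tail_equiv x y]].

Definition rep_invariant (Y : set PX) : Prop :=
  forall a : subshift_algebra, rep a @` Y `<=` Y.

End Algebra.
End Subshift.

Arguments rep_invariant {A} F {R} Y.
Arguments class_module {A F} R x.

(* Main.v *)
Require Import Defs.
From mathcomp Require Import all_boot all_algebra finmap all_classical.

Import GRing.Theory.
Local Open Scope classical_set_scope.
Local Open Scope ring_scope.

(* Every generator sends a basis vector to 0 or to a basis vector of the same
   tail class, whence (1). For (2), let v be a nonzero vector of an invariant
   subspace Y and x0 a point of its support. A finite intersection of cylinder
   sets C(omega, w) separates x0 from the rest of the support, so Y contains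
   a nonzero multiple of delta_x0, hence delta_x0. Applying s_a^* and s_a moves
   between a point and its shift in both directions, hence reaches all of the
   tail class of x0. *)

Section SubmoduleTheory.
Context {R : comPzRingType}.

Lemma submodule_preim (V W : lmodType R) (f : {linear V -> W}) (Y : set W) :
  submodule Y -> submodule (f @^-1` Y).
Proof.
move=> /submoduleP[Y0 YD YZ]; apply/submoduleP; split=> /=.
- by rewrite linear0.
- by move=> u v Yu Yv; rewrite linearD; exact: YD.
- by move=> r u Yu; rewrite linearZ; exact: YZ.
Qed.

Lemma submodule_span_sub (V : lmodType R) (G Y : set V) :
  submodule Y -> G `<=` Y -> submodule_span G `<=` Y.
Proof. by move=> Ysub GY v; apply; split. Qed.

Lemma sub_submodule_span (V : lmodType R) (G : set V) :
  G `<=` submodule_span G.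
Proof. by move=> v Gv Y [_]; exact. Qed.

(** With [D] a tail class, this turns membership in the span of the class into a condition on
    supports. *)
Lemma submodule_supp (T : choiceType) (D : set T) :
  submodule [set v : freemod R T | forall y, v y != 0 -> D y].
Proof.
apply/submoduleP; split=> [y|u v uD vD y|r u uD y].
- by rewrite freemod0E eqxx.
- rewrite freemodDE; have [->|/uD//] := eqVneq (u y) 0.
  by rewrite add0r; exact: vD.
- rewrite freemodZE; have [->|/uD//] := eqVneq (u y) 0.
  by rewrite mulr0 eqxx.
Qed.

End SubmoduleTheory.

Section Tail.
Context {A : Type}.

Lemma tail_equiv_shift (x y : nat -> A) :
  tail_equiv x (shift y) <-> tail_equiv x y.
Proof.
split=> -[n [m xy]]; first by exists n, m.+1; rewrite iterSr.
by exists n.+1, m; rewrite -iterSr !iterS xy.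
Qed.

Lemma tail_equiv_trans (x y z : nat -> A) :
  tail_equiv x y -> tail_equiv x z -> tail_equiv y z.
Proof.
(* Both sides become the shift of [x] by [n + n']. *)
move=> [n [m xy]] [n' [m' xz]]; exists (n' + m)%N, (n + m')%N.
by rewrite !iterD -xy -xz -!iterD addnC.
Qed.

Lemma wcat_prefix (x : nat -> A) n :
  wcat [seq x k | k <- iota 0 n] (iter n (@shift A) x) = x.
Proof.
elim: n x => [//|n IH] x; rewrite iterSr /= -[RHS]scons_shift; congr scons.
by rewrite -[RHS]IH -[1%N]addn0 iotaDl -map_comp.
Qed.

Lemma wcat_prefixE (x z : nat -> A) n k : (k < n)%N ->
  wcat [seq x i | i <- iota 0 n] z k = x k.
Proof.
elim: n x k => [//|n IH] x [//|k] kn /=.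
by rewrite -[1%N]addn0 iotaDl -map_comp (IH (shift x)).
Qed.

End Tail.

Section Representation.
Context {A : Type} {F : set (seq A)}.

Lemma belt_separate (x y : spoint F) : y <> x ->
  exists B : belt F, bset B x /\ ~ bset B y.
Proof.
move=> yx.
have [k yxk] : exists k, y k <> x k.
  apply: contra_notP yx => /forallNP yx; apply/spoint_inj/funext=> k.
  by apply: contrapT; exact: yx.
(* Length [k.+1] makes [w] include the letter at position [k], where [x] and [y] differ. *)
pose w := [seq x i | i <- iota 0 k.+1].
have l0 : language F [::] by exists x; [exact: pvalP|exists 0%N].
have lw : language F w.
  by exists x; [exact: pvalP|exists 0%N; rewrite size_map size_iota].
exists (beltC l0 lw); split=> /= [|[z [yz _]]]; last first.
  by apply: yxk; rewrite yz wcat_prefixE.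
(* As alpha is the empty word, the second condition only asks that this tail of [x] lie in the
   subshift. *)
exists (iter k.+1 (@shift A) x); rewrite wcat_prefix; split=> //.
elim: k.+1 => [|n IH] /=; [exact: pvalP|exact: subshift_shift].
Qed.

(** Intersect the separating sets of the points of [s] other than [x]. Since [s] may contain [x], it
    can be a whole support. *)
Lemma belt_isolate (x : spoint F) (s : seq (spoint F)) :
  exists2 B : belt F, bset B x & forall y, y \in s -> bset B y -> y = x.
Proof.
elim: s => [|y s [B Bx Bs]]; first by exists (beltT F).
have [->|/eqP yx] := eqVneq y x.
  by exists B => // z; rewrite inE => /predU1P[->|/Bs].
have [D [Dx Dy]] := belt_separate x y yx.
exists (beltI B D) => // z; rewrite inE => /predU1P[->|/Bs zx] [] //.
by move=> /zx.
Qed.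

Section Ring.
Context {R : comPzRingType}.

Lemma class_module_delta (x y : spoint F) :
  tail_equiv x y -> class_module R x (delta R y).
Proof. by move=> xy; apply: sub_submodule_span; exists y. Qed.

Lemma class_module_supp (x y : spoint F) (v : PX F R) :
  class_module R x v -> v y != 0 -> tail_equiv x y.
Proof.
move=> xv; move: v xv y.
pose D : set (spoint F) := [set y | tail_equiv x y].
apply: (@submodule_span_sub _ _ _ _ (@submodule_supp R _ D)).
move=> _ [z xz <-] y; rewrite deltaE.
by have [->|] := eqVneq y z; rewrite ?eqxx.
Qed.

Lemma op_gen_class_module (g : sgen F) (x y : spoint F) :
  tail_equiv x y -> class_module R x (op_gen R g (delta R y)).
Proof.
have /submoduleP[CM0 _ _] : submodule (class_module R x).
  exact: submodule_span_submodule.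
case: g => [B|a|a] xy /=.
- by rewrite opPE; case: ifP => // _; exact: class_module_delta.
- rewrite opSE; case: pselect => // ax; apply: class_module_delta => /=.
  by apply/tail_equiv_shift; rewrite shift_scons.
- rewrite opSsE; case: ifP => // _; apply: class_module_delta.
  exact/tail_equiv_shift.
Qed.

Lemma class_module_invariant (x : spoint F) :
  rep_invariant F (class_module R x).
Proof.
have CMsub : submodule (class_module R x) by exact: submodule_span_submodule.
have /submoduleP[_ CMD CMZ] := CMsub.
(* Every element of the algebra is the class of a term, so induction on terms reduces the claim to
   generators. *)
elim/presented_ind=> t _ [v xv <-].
have -> : rep F R (pclass _ t) = aeval (op_gen R) t.
  exact: plift_class.
elim: t v xv => [g|r|t IH|t IHt u IHu|t IHt u IHu] v xv.
(* The vectors sent into the class module form a submodule, so it suffices to test the spanning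
   basis vectors. *)
- move: v xv; apply: submodule_span_sub; first exact: submodule_preim.
  by move=> _ [y xy <-]; exact: op_gen_class_module.
- by rewrite [_ v]endo_ualgE; exact: CMZ.
- by rewrite [_ v]endoNE -scaleN1r; apply: CMZ; exact: IH.
- by rewrite [_ v]endoDE; apply: CMD; [exact: IHt|exact: IHu].
- by rewrite [_ v]endoME; apply: IHt; exact: IHu.
Qed.

Lemma opP_isolate (x : spoint F) (v : PX F R) :
  exists B : belt F, opP R B v = (v x : R) *: (delta R x : PX F R).
Proof.
pose S := fset_set [set y | v y != 0].
have vS y : v y != 0 -> y \in S.
  by move=> vy; rewrite in_fset_set ?mem_set//; exact: freemod_finite.
have [B Bx BS] := belt_isolate x S; exists B.
apply: freemodP => y; rewrite freemodZE deltaE.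
have -> : opP R B v = \sum_(z <- S) (v z : R) *:
    (if `[< bset B z >] then delta R z else 0 : PX F R).
  exact: freemod_ext_funE.
(* If [x] is outside the support, [B] misses the support and both sides are 0; otherwise only the
   term at [x] survives. *)
have [xS|xS] := boolP (x \in S); last first.
  have -> : v x = 0 by apply/eqP; apply: contraNT xS; exact: vS.
  rewrite big_seq big1 ?mul0r// => z zS; case: asboolP => [/(BS z zS) zx|_].
    by rewrite zx in zS; rewrite zS in xS.
  by rewrite scaler0.
rewrite (big_fsetD1 x)//= asboolT// big_seq big1 ?addr0//.
move=> z; rewrite in_fsetD1 => /andP[/eqP zx zS].
by rewrite asboolF ?scaler0// => /(BS z zS).
Qed.

Section Invariant.
Context (Y : set (PX F R)) (Yinv : rep_invariant F Y).

Lemma rep_invariant_op (g : sgen F) v : Y v -> Y (op_gen R g v).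
Proof.
move=> Yv; apply: (Yinv (pgen _ g)); exists v => //.
by congr ((_ : endo _) v); exact: plift_gen.
Qed.

Lemma rep_invariant_shift (y : spoint F) :
  Y (delta R (pshift y)) <-> Y (delta R y).
Proof.
(* The letter is the first one of [y]: prepending it to the shift of [y] gives back [y], which lies
   in the subshift, so neither operator vanishes here. *)
split=> [/(rep_invariant_op (GS F (y 0%N)))|/(rep_invariant_op (GSs F (y 0%N)))].
  rewrite /= opSE; case: pselect => [ax|[]]; last first.
    by rewrite scons_shift; exact: pvalP.
  by congr (Y (delta R _)); apply: spoint_inj; rewrite /= scons_shift.
by rewrite /= opSsE asboolT.
Qed.

Lemma rep_invariant_tail (y z : spoint F) :
  tail_equiv y z -> Y (delta R y) -> Y (delta R z).
Proof.
have Yiter n u : Y (delta R (iter n (@pshift A F) u)) <-> Y (delta R u).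
  by elim: n => //= n <-; exact: rep_invariant_shift.
have iterE n (u : spoint F) :
    iter n (@pshift A F) u = iter n (@shift A) u :> (nat -> A).
  by elim: n => //= n ->.
(* Descend from [y] to the common shift, then climb back to [z]. *)
move=> [n [m yz]] /(Yiter n) Yy; apply/(Yiter m).
by congr (Y (delta R _)): Yy; apply: spoint_inj; rewrite !iterE.
Qed.

End Invariant.
End Ring.

Lemma class_module_min (K : fieldType) (x : spoint F) (Y : set (PX F K)) :
  submodule Y -> Y <> [set 0] -> Y `<=` class_module K x ->
  rep_invariant F Y -> class_module K x `<=` Y.
Proof.
move=> Ysub Yn0 Yx Yinv; have /submoduleP[Y0 _ YZ] := Ysub.
have [v [Yv vn0]] : exists v, Y v /\ v <> 0.
  apply: contra_notP Yn0 => /forallNP Yv; apply/seteqP; split=> [v Yv'|_ ->//].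
  by apply: contrapT => vn0; apply: (Yv v).
have [y vy] : exists y, v y != 0.
  apply: contra_notP vn0 => /forallNP v0; apply: freemodP => y.
  exact/eqP/negPn/negP/v0.
have Yy : Y (delta K y).
  have [B Bv] := opP_isolate y v.
  (* The field hypothesis enters here: the nonzero coefficient [v y] is invertible. *)
  have -> : delta K y = (v y : K)^-1 *: opP K B v.
    by rewrite Bv scalerA mulVf// scale1r.
  by apply: YZ; exact: (rep_invariant_op _ Yinv (GP B)).
apply: submodule_span_sub => // _ [z xz <-].
apply: (rep_invariant_tail _ Yinv y) => //.
(* As [v] lies in the class module of [x], its support point [y] is tail equivalent to [x], hence to
   [z]. *)
by apply: tail_equiv_trans xz; apply: class_module_supp vy; exact: Yx.
Qed.

End Representation.

Theorem theorem3p9 (A : Type) (A_nonempty : inhabited A) (F : set (seq A)) :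
  (forall (R : comPzRingType) (x : spoint F),
     rep_invariant F (class_module R x)) /\
  (forall (K : fieldType) (x : spoint F),
     ~ exists Y : set (PX F K),
         [/\ submodule Y, Y <> [set 0], Y `<` class_module K x &
             rep_invariant F Y]).
Proof.
split=> [R x|K x [Y [Ysub Yn0 [Yx nxY] Yinv]]].
  exact: class_module_invariant.
by apply: nxY; exact: class_module_min.
Qed.
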